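(* There exists an absolute constant $c_2 > 0$ such that the following holds. Let $d \ge 1$ be an integer and let $(X, \mathcal{F})$ be a finite set system such that $|\mathcal{F}|_Y| \leq \left( e |Y|/d \right)^d$ for all $Y \subseteq X$ with $|Y| \geq d$. Let $0 < \delta, \epsilon, \gamma < 1/2$ be given parameters. Then for any integer $t$ with $t \le |X|$ and $$t \geq c_2 \, \max \left\{ \frac{1}{\epsilon \delta} \ln \frac{|\mathcal{F}|}{\gamma},\ \frac{1}{\epsilon \delta^2} \ln \left( \frac{1}{\epsilon^d\gamma} \right) \right\},$$ a uniform random sample $A \subseteq X$ of size $t$ is a relative $(\epsilon,\delta)$-approximation for $(X,\mathcal{F})$ with probability at least $1 - \gamma$.
   Context: A finite set system $(X,\mathcal{F})$ consists of a finite set $X$ and a family $\mathcal{F}$ of subsets of $X$. For $Y \subseteq X$, $\mathcal{F}|_Y = \{ Y \cap S : S \in \mathcal{F} \}$. Here $e$ is the base of the natural logarithm. A uniform random sample of $X$ of size $t$ is a set $A$ selected uniformly at random from the $\binom{|X|}{t}$ subsets of $X$ of size $t$. With $n = |X|$, a set $A \subseteq X$ of size $t$ is a relative $(\epsilon,\delta)$-approximation for $(X,\mathcal{F})$ if for all $S \in \mathcal{F}$, $$\left| \frac{|S|}{n} - \frac{|A \cap S|}{t} \right| \leq \delta \cdot \max\left\{ \frac{|S|}{n}, \epsilon \right\}.$$ ''Absolute constant'' means that $c_2$ does not depend on $X$, $\mathcal{F}$, $d$, $\epsilon$, $\delta$, $\gamma$ or $t$. *)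

(* Defs.v *)
From mathcomp Require Import all_boot all_order all_algebra.
From mathcomp Require Import reals.

Set Implicit Arguments.
Unset Strict Implicit.
Unset Printing Implicit Defensive.

Import Order.TTheory GRing.Theory Num.Theory.

Local Open Scope ring_scope.

(* A finite set system (X, F) is a finite type X of points together with
   F : {set {set X}}. *)

Definition trace (X : finType) (F : {set {set X}}) (Y : {set X}) :
  {set {set X}} := [set Y :&: S | S in F].

(* The sample size t of the usual definition is #|A|. *)
Definition relative_approx (R : realType) (X : finType) (F : {set {set X}})
    (eps delta : R) (A : {set X}) : bool :=
  [forall S in F,
    `| #|S|%:R / #|X|%:R - #|A :&: S|%:R / #|A|%:R |
      <= delta * Num.max (#|S|%:R / #|X|%:R) eps].

(* Probability that the event E holds for A drawn uniformly among the
   t-element subsets of X; there are such subsets only when t <= #|X|. *)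
Definition sample_prob (R : realType) (X : finType) (t : nat)
    (E : pred {set X}) : R :=
  #|[set A : {set X} | (#|A| == t) && E A]|%:R / 'C(#|X|, t)%:R.

(* Main.v *)
(* Chaining.  Fix 1/eps <= b <= 2/eps and let N_i be a maximal subfamily of F
   whose members pairwise differ in at least |X| / (b 16^i) points, so that
   every member of F is that close to N_i.  A packing argument bounds |N_i| by
   (32 b 16^i)^(2d).  Each S in F is reached from N_0 through N_1, ..., N_k,
   where 16^(-k) is about delta, and the discrepancy of S is the discrepancy of
   a member of N_0 plus those of the differences along the chain.  At scale i
   these differences have density at most eps / 16^i and are allowed the
   discrepancy delta eps / (16 2^i): the allowed discrepancies sum to
   O(delta eps), while the Chernoff exponent t delta^2 eps 4^i / 2048 grows
   faster than ln |N_i|.  The last step, from N_k to F, is a union bound over F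
   at density eps delta; it is the only place where ln |F| enters. *)
Require Import Defs.
From mathcomp Require Import all_boot all_order all_algebra.
From mathcomp Require Import reals sequences exp.
From mathcomp Require Import ring lra zify.

Set Implicit Arguments.
Unset Strict Implicit.
Unset Printing Implicit Defensive.

Import Order.TTheory GRing.Theory Num.Theory.

Local Open Scope ring_scope.

(** * Tail bound for sampling without replacement *)

(** Removing [K] is a bijection onto the (t - |K|)-subsets of the complement of [K]; its inverse is
    the union with [K]. *)
Lemma card_draws_superset (X : finType) (K : {set X}) (t : nat) :
  (#|K| <= t)%N ->
  #|[set A : {set X} | (#|A| == t) && (K \subset A)]|
    = 'C(#|X| - #|K|, t - #|K|).
Proof.
move=> leKt.
have -> : (#|X| - #|K| = #|~: K|)%N by rewrite [RHS]cardsCs setCK.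
rewrite -cards_draws.
rewrite -[RHS](card_in_imset (f := fun A : {set X} => A :|: K)); last first.
  move=> A B; rewrite !inE => /andP[sA _] /andP[sB _] eAB.
  have E (C : {set X}) : C \subset ~: K -> (C :|: K) :\: K = C.
    by rewrite setDUl setDv setU0 setDE => /setIidPl.
  by rewrite -(E A sA) eAB E.
apply: eq_card => A; rewrite !inE; apply/andP/imsetP.
  move=> [/eqP cA sKA]; exists (A :\: K); last first.
    by rewrite -{1}(setID A K) (setIidPr sKA) setUC.
  rewrite !inE setDE subsetIr /= -setDE cardsD (setIidPr sKA) cA eqxx //.
move=> [B]; rewrite inE => /andP[sB /eqP cB] ->; split; last exact: subsetUr.
rewrite cardsU cB; have -> : B :&: K = set0.
  by apply/eqP; rewrite setI_eq0 disjoints_subset.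
by rewrite cards0 subn0 subnK.
Qed.

(** Double counting of the pairs (K, A) with |K| = k, |A| = t and K contained in both A and S. *)
Lemma sum_bin_setI (X : finType) (S : {set X}) (t k : nat) :
  (k <= t)%N ->
  (\sum_(A : {set X} | #|A| == t) 'C(#|A :&: S|, k)
    = 'C(#|S|, k) * 'C(#|X| - k, t - k))%N.
Proof.
move=> lekt.
under eq_bigr => A _ do rewrite -cards_draws -sum1dep_card.
rewrite (exchange_big_dep (fun K : {set X} => (K \subset S) && (#|K| == k))) /=.
  rewrite -cards_draws -sum1dep_card big_distrl /=.
  apply: eq_bigr => K /andP[sKS /eqP cK].
  rewrite mul1n -cK -card_draws_superset ?cK // -sum1dep_card.
  apply: eq_bigl => A.
  by rewrite subsetI sKS eqxx !andbT.
by move=> A K _; rewrite subsetI => /andP[/andP[_ ->] ->].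
Qed.

(** Factor by factor: (s - j) n <= (n - j) s, because s <= n. *)
Lemma ffact_ratio_le (s n k : nat) :
  (s <= n)%N -> (s ^_ k * n ^ k <= n ^_ k * s ^ k)%N.
Proof.
move=> lesn; elim: k => // k IH; rewrite !ffactnSr !expnSr.
rewrite mulnACA [leqRHS]mulnACA leq_mul // mulnBl mulnBl.
by rewrite (mulnC n s) leq_sub2l // leq_mul2l lesn orbT.
Qed.

Lemma bin_ratio_le (s n k : nat) :
  (s <= n)%N -> ('C(s, k) * n ^ k <= 'C(n, k) * s ^ k)%N.
Proof.
move=> lesn; rewrite -(leq_pmul2r (fact_gt0 k)).
by rewrite mulnAC bin_ffact [leqRHS]mulnAC bin_ffact ffact_ratio_le.
Qed.

Lemma bin_trinomial (n t k : nat) : (k <= t <= n)%N ->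
  ('C(n, k) * 'C(n - k, t - k) = 'C(n, t) * 'C(t, k))%N.
Proof.
move=> /andP[lekt letn]; have lekn := leq_trans lekt letn.
have h1 := bin_fact lekn; have h2 := bin_fact lekt; have h3 := bin_fact letn.
have h4 : (t - k <= n - k)%N by rewrite leq_sub2r.
move: (bin_fact h4); rewrite subnBA // subnK // => h5.
have P : (0 < k`! * (t - k)`! * (n - t)`!)%N by rewrite !muln_gt0 !fact_gt0.
apply/eqP; rewrite -(eqn_pmul2r P); apply/eqP.
transitivity n`!; first by rewrite -h1 -h5; ring.
by rewrite -h3 -h2; ring.
Qed.

Section Hypergeometric.
Variables (R : realType) (X : finType).

(** The right side is the binomial moment of t independent draws, so sampling without replacement
    has no larger moments than sampling with replacement. *)
Lemma factorial_moment_le (S : {set X}) (t k : nat) :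
  (0 < #|X|)%N -> (k <= t <= #|X|)%N ->
  \sum_(A : {set X} | #|A| == t) 'C(#|A :&: S|, k)%:R
    <= 'C(#|X|, t)%:R * ('C(t, k)%:R * (#|S|%:R / #|X|%:R) ^+ k) :> R.
Proof.
move=> X0 lktn; rewrite -natr_sum sum_bin_setI; last by case/andP: lktn.
rewrite mulrA -natrM -bin_trinomial // !natrM mulrAC ler_wpM2r //.
rewrite expr_div_n mulrA ler_pdivlMr ?exprn_gt0 ?ltr0n //.
by rewrite -!natrX -!natrM ler_nat bin_ratio_le // max_card.
Qed.

(* Expanding x^m = (1 + (x - 1))^m reduces the moment generating function to
   factorial moments; x >= 1 makes all coefficients nonnegative. *)
Lemma sample_mgf_le (S : {set X}) (t : nat) (x : R) :
  (0 < #|X|)%N -> (t <= #|X|)%N -> 1 <= x ->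
  \sum_(A : {set X} | #|A| == t) x ^+ #|A :&: S|
    <= 'C(#|X|, t)%:R * (1 + (x - 1) * (#|S|%:R / #|X|%:R)) ^+ t.
Proof.
move=> X0 tX x1.
have E (A : {set X}) : #|A| == t -> x ^+ #|A :&: S|
    = \sum_(k < t.+1) (x - 1) ^+ k * 'C(#|A :&: S|, k)%:R.
  move=> /eqP cA; have le : (#|A :&: S| <= t)%N by rewrite -cA subset_leq_card ?subsetIl.
  rewrite -{1}(subrK 1 x) addrC exprDn.
  (* The range is extended to all k <= t, the same for every A; the added binomials vanish. *)
  rewrite (big_ord_widen t.+1 (fun k => 1 ^+ (#|A :&: S| - k) * (x - 1) ^+ k *+ 'C(#|A :&: S|, k))) //.
  rewrite big_mkcond /=; apply: eq_bigr => k _.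
  rewrite expr1n mul1r ltnS; case: leqP => h; first by rewrite mulr_natr.
  by rewrite bin_small // mulr0.
under eq_bigr => A cA do rewrite E //.
rewrite exchange_big /= exprDn mulr_sumr; apply: ler_sum => k _.
rewrite -mulr_sumr expr1n mul1r exprMn.
apply: (@le_trans _ _ ((x - 1) ^+ k * ('C(#|X|, t)%:R * ('C(t, k)%:R * (#|S|%:R / #|X|%:R) ^+ k)))).
  apply: ler_wpM2l; first by rewrite exprn_ge0 // subr_ge0.
  by apply: factorial_moment_le => //; rewrite tX -ltnS ltn_ord.
by rewrite -mulr_natr le_eqVlt; apply/orP; left; apply/eqP; ring.
Qed.

(** From 1 - x <= exp(-x) one gets (1 - x) exp(x) <= 1, and (1 - x)(1 + x + 2x^2) exceeds 1 by x^2
    (1 - 2x). *)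
Lemma expR_le_quadratic (x : R) : `|x| <= 1 / 2 -> expR x <= 1 + x + 2 * x ^+ 2.
Proof.
rewrite ler_norml => /andP[h1 h2].
have h : (1 - x) * expR x <= 1.
  rewrite -[leRHS](expRxMexpNx_1 x) mulrC ler_pM2l ?expR_gt0 //.
  exact: expR_ge1Dx.
rewrite -(ler_pM2l (_ : 0 < 1 - x)); last lra.
apply: le_trans h _; rewrite -subr_ge0.
have -> : (1 - x) * (1 + x + 2 * x ^+ 2) - 1 = x ^+ 2 * (1 - 2 * x) by ring.
by rewrite mulr_ge0 ?sqr_ge0 //; lra.
Qed.

(** The error is kept signed, so that it is additive over disjoint sets. *)
Definition disc (A S : {set X}) : R :=
  #|S|%:R / #|X|%:R - #|A :&: S|%:R / #|A|%:R.

(** Take x = exp(l) in the moment bound: centring by the mean cancels the term linear in l and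
    leaves 2 l^2 per unit of expected hits. *)
Lemma sample_mgf_upper (S : {set X}) (t : nat) (l : R) :
  (0 < #|X|)%N -> (0 < t <= #|X|)%N -> 0 <= l <= 1 / 2 ->
  \sum_(A : {set X} | #|A| == t) expR (l * (t%:R * - disc A S))
    <= 'C(#|X|, t)%:R * expR (2 * t%:R * (#|S|%:R / #|X|%:R) * l ^+ 2).
Proof.
move=> X0 /andP[t0 tX] /andP[l0 l1]; set p := #|S|%:R / #|X|%:R.
have p0 : 0 <= p by rewrite divr_ge0.
have tn0 : t%:R != 0 :> R by rewrite pnatr_eq0 -lt0n.
have -> : \sum_(A : {set X} | #|A| == t) expR (l * (t%:R * - disc A S))
    = expR (- (t%:R * (l * p))) * \sum_(A : {set X} | #|A| == t) expR l ^+ #|A :&: S|.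
  rewrite mulr_sumr; apply: eq_bigr => A /eqP cA.
  rewrite -expRM_natl -expRD; congr expR; rewrite /disc -/p cA; by field.
have x1 : 1 <= expR l by rewrite leNgt expR_lt1 -leNgt.
have mgf := @sample_mgf_le S t (expR l) X0 tX (x1).
apply: le_trans (ler_wpM2l (expR_ge0 _) mgf) _.
rewrite mulrCA ler_wpM2l // -/p.
have base : 1 + (expR l - 1) * p <= expR ((l + 2 * l ^+ 2) * p).
  apply: le_trans (expR_ge1Dx _); rewrite lerD2l ler_wpM2r //.
  have := @expR_le_quadratic l; rewrite ger0_norm // => /(_ l1); lra.
apply: le_trans (ler_wpM2l (expR_ge0 _) (lerXn2r t _ _ base)) _.
- by rewrite nnegrE addr_ge0 // mulr_ge0 // subr_ge0.
- by rewrite nnegrE expR_ge0.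
rewrite -expRM_natl -expRD ler_expR le_eqVlt; apply/orP; left; apply/eqP; ring.
Qed.

Lemma disc_setC (A S : {set X}) : (0 < #|X|)%N -> (0 < #|A|)%N ->
  disc A (~: S) = - disc A S.
Proof.
move=> X0 A0; rewrite /disc.
have h1 : #|S|%:R + #|~: S|%:R = #|X|%:R :> R by rewrite -natrD cardsC.
have h2 : #|A :&: S|%:R + #|A :&: ~: S|%:R = #|A|%:R :> R.
  by rewrite -natrD -setDE cardsID.
have n1 : #|X|%:R != 0 :> R by rewrite pnatr_eq0 -lt0n.
have n2 : #|A|%:R != 0 :> R by rewrite pnatr_eq0 -lt0n.
have -> : #|~: S|%:R = #|X|%:R - #|S|%:R :> R by rewrite -h1; ring.
have -> : #|A :&: ~: S|%:R = #|A|%:R - #|A :&: S|%:R :> R by rewrite -h2; ring.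
by field; rewrite n1 n2.
Qed.

(* The lower tail is the upper tail of the complement; it is not enough to apply
   [sample_mgf_upper] to [~: S], whose density need not be small. *)
Lemma sample_mgf_lower (S : {set X}) (t : nat) (l : R) :
  (0 < #|X|)%N -> (0 < t <= #|X|)%N -> 0 <= l <= 1 / 2 ->
  \sum_(A : {set X} | #|A| == t) expR (l * (t%:R * disc A S))
    <= 'C(#|X|, t)%:R * expR (2 * t%:R * (#|S|%:R / #|X|%:R) * l ^+ 2).
Proof.
move=> X0 /andP[t0 tX] /andP[l0 l1]; set p := #|S|%:R / #|X|%:R.
have p0 : 0 <= p by rewrite divr_ge0.
have tn0 : t%:R != 0 :> R by rewrite pnatr_eq0 -lt0n.
have Xn0 : #|X|%:R != 0 :> R by rewrite pnatr_eq0 -lt0n.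
have pC : #|~: S|%:R / #|X|%:R = 1 - p.
  rewrite /p; have h1 : #|S|%:R + #|~: S|%:R = #|X|%:R :> R by rewrite -natrD cardsC.
  have -> : #|~: S|%:R = #|X|%:R - #|S|%:R :> R by rewrite -h1; ring.
  by field.
have -> : \sum_(A : {set X} | #|A| == t) expR (l * (t%:R * disc A S))
    = expR (- (t%:R * (l * (1 - p)))) * \sum_(A : {set X} | #|A| == t) expR l ^+ #|A :&: ~: S|.
  rewrite mulr_sumr; apply: eq_bigr => A /eqP cA.
  have -> : disc A S = - disc A (~: S) by rewrite disc_setC ?opprK ?cA.
  rewrite -expRM_natl -expRD; congr expR; rewrite /disc pC cA; by field.
have x1 : 1 <= expR l by rewrite leNgt expR_lt1 -leNgt.
have mgf := @sample_mgf_le (~: S) t (expR l) X0 tX (x1).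
apply: le_trans (ler_wpM2l (expR_ge0 _) mgf) _.
rewrite mulrCA ler_wpM2l // pC.
have q0 : 0 <= 1 - p by rewrite -pC divr_ge0.
have base : 1 + (expR l - 1) * (1 - p) <= expR (l + (2 * l ^+ 2 - l) * p).
  (* Factoring out exp(l) makes the error term proportional to the density p of [S] instead of that
     of its complement. *)
  have -> : 1 + (expR l - 1) * (1 - p) = expR l * (1 + (expR (- l) - 1) * p).
    have := expRxMexpNx_1 l; set a := expR l; set b := expR _ => h.
    have -> : a * (1 + (b - 1) * p) = a + (a * b - a) * p by ring.
    by rewrite h; ring.
  rewrite expRD ler_pM2l ?expR_gt0 //.
  apply: le_trans (expR_ge1Dx _); rewrite lerD2l ler_wpM2r //.
  have := @expR_le_quadratic (- l); rewrite normrN ger0_norm // sqrrN => /(_ l1); lra.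
apply: le_trans (ler_wpM2l (expR_ge0 _) (lerXn2r t _ _ base)) _.
- by rewrite nnegrE addr_ge0 // mulr_ge0 // subr_ge0.
- by rewrite nnegrE expR_ge0.
rewrite -expRM_natl -expRD ler_expR le_eqVlt; apply/orP; left; apply/eqP; ring.
Qed.

Lemma sample_tail (S : {set X}) (t : nat) (s h : R) :
  (0 < #|X|)%N -> (0 < t <= #|X|)%N ->
  #|S|%:R / #|X|%:R <= s -> 0 < h <= 2 * s ->
  #|[set A : {set X} | (#|A| == t) && (h < `|disc A S|)]|%:R
    <= 2 * expR (- (t%:R * h ^+ 2 / (8 * s))) * 'C(#|X|, t)%:R.
Proof.
move=> X0 tX ps /andP[h0 hs].
have s0 : 0 < s by lra.
have t0 : 0 < t%:R :> R by rewrite ltr0n; case/andP: tX.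
(* This l minimizes 2 t s l^2 - l t h, with value - t h^2 / (8 s); the bound h <= 2 s gives l <=
   1/2. *)
pose l := h / (4 * s).
have l0 : 0 < l by rewrite divr_gt0 //; lra.
have l1 : l <= 1 / 2 by rewrite /l ler_pdivrMr; lra.
have lb : 0 <= l <= 1 / 2 by rewrite ltW.
(* Markov's inequality for the sum of the two exponentials treats both tails at once. *)
have markov : #|[set A : {set X} | (#|A| == t) && (h < `|disc A S|)]|%:R
    * expR (l * (t%:R * h)) <= \sum_(A : {set X} | #|A| == t)
      (expR (l * (t%:R * - disc A S)) + expR (l * (t%:R * disc A S))).
  rewrite -sum1dep_card natr_sum mulr_suml big_mkcondr /=.
  apply: ler_sum => A _; case: ifP => [hA|_]; last by rewrite addr_ge0 ?expR_ge0.
  rewrite mul1r; case: (lerP 0 (disc A S)) => dA.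
    rewrite ger0_norm // in hA; apply: (@le_trans _ _ (expR (l * (t%:R * disc A S)))).
      by rewrite ler_expR !ler_pM2l // ltW.
    by rewrite lerDr expR_ge0.
  rewrite ltr0_norm // in hA; apply: (@le_trans _ _ (expR (l * (t%:R * - disc A S)))).
    by rewrite ler_expR !ler_pM2l // ltW.
  by rewrite lerDl expR_ge0.
rewrite -(ler_pM2r (expR_gt0 (l * (t%:R * h)))).
apply: le_trans markov _; rewrite big_split /=.
have := lerD (sample_mgf_upper S X0 tX lb) (sample_mgf_lower S X0 tX lb).
move=> /le_trans; apply.
have le1 : expR (2 * t%:R * (#|S|%:R / #|X|%:R) * l ^+ 2)
    <= expR (- (t%:R * h ^+ 2 / (8 * s))) * expR (l * (t%:R * h)).
  rewrite -expRD ler_expR.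
  apply: (@le_trans _ _ (2 * t%:R * s * l ^+ 2)).
    by rewrite ler_wpM2r ?sqr_ge0 // ler_wpM2l // mulr_ge0 // ltW.
  rewrite /l le_eqVlt; apply/orP; left; apply/eqP; field; lra.
have -> : 2 * expR (- (t%:R * h ^+ 2 / (8 * s))) * 'C(#|X|, t)%:R * expR (l * (t%:R * h))
    = 2 * 'C(#|X|, t)%:R * (expR (- (t%:R * h ^+ 2 / (8 * s))) * expR (l * (t%:R * h))) by ring.
by rewrite -mulr2n -[leLHS]mulr_natl [leLHS]mulrA ler_wpM2l // mulr_ge0.
Qed.

End Hypergeometric.

(** * Packing *)

Definition symdiff (X : finType) (S T : {set X}) := (S :\: T) :|: (T :\: S).

Lemma symdiff_trace (X : finType) (S T Y : {set X}) (y : X) :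
  y \in Y -> y \in symdiff S T -> Y :&: S != Y :&: T.
Proof.
move=> yY; apply: contraTneq => /setP /(_ y); rewrite !inE yY /= => ->.
by rewrite andNb.
Qed.

Lemma expR1_le4 (R : realType) : expR 1 <= 4 :> R.
Proof.
have -> : expR 1 = expR (1 / 2) ^+ 2 :> R.
  by rewrite -expRM_natl; congr expR; field.
have h : expR (1 / 2) <= 2 :> R.
  apply: (le_trans (expR_le_quadratic (x := 1 / 2) _)); last by lra.
  by rewrite ger0_norm //; lra.
apply: le_trans (_ : 2 ^+ 2 <= _); first by rewrite lerXn2r ?nnegrE ?expR_ge0.
by rewrite -natrX.
Qed.

(** Probabilistic method by counting: of the |X|^m sequences of m points, at most a^m miss the
    symmetric difference of a given pair, and there are at most |P|^2 pairs, so some sequence hits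
    them all. *)
Lemma exists_distinguishing_set (X : finType) (P : {set {set X}}) (a m : nat) :
  (0 < #|X|)%N ->
  {in P &, forall S T, S != T -> (#|X| - #|symdiff S T| <= a)%N} ->
  (#|P| ^ 2 * a ^ m < #|X| ^ m)%N ->
  exists Y : {set X}, (#|Y| <= m)%N /\
    {in P &, forall S T, S != T -> Y :&: S != Y :&: T}.
Proof.
move=> X0 sep small.
pose fails (p : {set X} * {set X}) :=
  [set g : {ffun 'I_m -> X} | [forall i, g i \notin symdiff p.1 p.2]].
pose pairs := [set p in setX P P | p.1 != p.2].
have cfails p : p \in pairs -> (#|fails p| <= a ^ m)%N.
  case: p => S T; rewrite !inE /= => /andP[/andP[SP TP] neST].
  apply: leq_trans (_ : (#|~: symdiff S T| ^ m <= _)%N).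
    rewrite -[m in leqRHS]card_ord -card_ffun_on; apply: subset_leq_card.
    apply/subsetP => g; rewrite inE => /forallP gS; apply/ffun_onP => i.
    by rewrite in_setC.
  have le_a : (#|~: symdiff S T| <= a)%N by rewrite cardsCs setCK sep.
  by case: (posnP m) => [->|m0]; rewrite ?expn0 // leq_exp2r.
have cpairs : (#|pairs| <= #|P| ^ 2)%N.
  rewrite -mulnn -cardsX; apply: subset_leq_card.
  by apply/subsetP => p; rewrite inE => /andP[].
have [g gok] : exists g, g \notin \bigcup_(p in pairs) fails p.
  apply/existsP; rewrite -negb_forall; apply: contraL small => /forallP all.
  rewrite -leqNgt -[m in (#|X| ^ m)%N]card_ord -card_ffun -cardsT.
  apply: leq_trans (_ : (\sum_(p in pairs) #|fails p| <= _)%N).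
    apply: leq_trans (subset_leq_card (B := \bigcup_(p in pairs) fails p) _) _.
      by apply/subsetP => g _; exact: all.
    by elim/big_ind2: _ => // [|A1 n1 A2 n2 h1 h2]; rewrite ?cards0 // (leq_trans (leq_card_setU _ _)) // leq_add.
  apply: leq_trans (_ : (\sum_(p in pairs) a ^ m <= _)%N).
    by apply: leq_sum => p; exact: cfails.
  by rewrite sum_nat_const leq_mul2r cpairs orbT.
exists [set g i | i : 'I_m]; split.
  by rewrite (leq_trans (leq_imset_card _ _)) // card_ord.
move=> S T SP TP neST; move: gok; apply: contraNneq => eqST.
apply/bigcupP; exists (S, T); first by rewrite !inE SP TP.
rewrite inE; apply/forallP => i /=.
by apply: contra_eqN eqST => iST; apply: symdiff_trace iST; exact: imset_f.
Qed.

(** For |Y| >= d the growth hypothesis applies, with e bounded by 4; for |Y| < d there are at most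
    2^d subsets of Y. *)
Lemma trace_card_le (R : realType) (X : finType) (F : {set {set X}}) (d r : nat)
    (Y : {set X}) :
  (0 < d)%N -> (0 < r)%N ->
  (forall Y : {set X}, (d <= #|Y|)%N ->
     #|trace F Y|%:R <= (expR 1 * #|Y|%:R / d%:R) ^+ d :> R) ->
  (#|Y| <= d * r)%N -> (#|trace F Y| <= (4 * r) ^ d)%N.
Proof.
move=> d0 r0 shatter leY; case: (leqP d #|Y|) => dY.
  rewrite -(ler_nat R) natrX; apply: le_trans (shatter _ dY) _.
  apply: lerXn2r; rewrite ?nnegrE ?divr_ge0 ?mulr_ge0 ?expR_ge0 //.
  rewrite ler_pdivrMr ?ltr0n // natrM -mulrA -natrM ler_pM ?expR_ge0 //.
    exact: expR1_le4.
  by rewrite ler_nat mulnC.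
apply: leq_trans (subset_leq_card (B := powerset Y) _) _.
  by apply/subsetP => Z /imsetP[S _ ->]; rewrite inE subsetIl.
rewrite card_powerset; apply: leq_trans (_ : (2 ^ d <= _)%N).
  by rewrite leq_exp2l // ltnW.
by rewrite leq_exp2r //; lia.
Qed.

(* The exponential over [R] serves only the proof. *)
Lemma power_gap (R : realType) (b d : nat) : (0 < b)%N -> (0 < d)%N ->
  (((32 * b) ^ (2 * d)) ^ 2 * b.-1 ^ (d * (128 * b ^ 2)) < b ^ (d * (128 * b ^ 2)))%N.
Proof.
case: b => // b _ d0; have m0 : (0 < d * (128 * b.+1 ^ 2))%N by lia.
case: b m0 => [|b] m0 /=; first by rewrite exp0n // muln0 expn_gt0.
set m := (d * _)%N; rewrite -(ltr_nat R) natrM !natrX -!exprM.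
have nb : b.+2%:R != 0 :> R by rewrite pnatr_eq0.
(* With B = [b.+2], e = exp(1/B) satisfies e (B - 1) <= B, while e^m = exp(32 B)^(4d) exceeds (32
   B)^(4d). *)
pose e : R := expR (b.+2%:R^-1).
have em : e ^+ m = expR (32 * b.+2)%:R ^+ (2 * d * 2).
  rewrite -!expRM_natl /m; congr expR; rewrite !natrM.
  by field; rewrite -natrD pnatr_eq0.
have lt1 : (32 * b.+2)%:R ^+ (2 * d * 2) < e ^+ m.
  rewrite em ltrXn2r ?muln_eq0 ?negb_or -?lt0n ?d0 //.
  by apply: lt_le_trans (expR_ge1Dx _); rewrite ltrDr.
have le2 : e * b.+1%:R <= b.+2%:R.
  have h := expR_ge1Dx (- b.+2%:R^-1 : R).
  rewrite -(ler_pM2l (expR_gt0 (- b.+2%:R^-1 : R))) mulrA mulrC [expR _ * e]mulrC.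
  rewrite expRxMexpNx_1 mulr1; apply: le_trans (ler_wpM2r (ler0n _ _) h).
  have -> : b.+1%:R = b.+2%:R - 1 :> R by rewrite -[b.+2]addn1 natrD addrK.
  by rewrite le_eqVlt; apply/orP; left; apply/eqP; field; rewrite -natrD pnatr_eq0.
apply: lt_le_trans (_ : e ^+ m * b.+1%:R ^+ m <= _).
  by rewrite ltr_pM2r // exprn_gt0 ?ltr0n.
by rewrite -exprMn lerXn2r ?nnegrE ?mulr_ge0 ?expR_ge0.
Qed.

(* Of a family larger than [N = (32 b)^(2 d)] keep only [N] members: then
   [128 b^2 d] random points distinguish all of them, although they leave at
   most [(512 b^2)^d < N] traces. *)
Lemma card_separated_lt (R : realType) (X : finType) (F P : {set {set X}}) (d b : nat) :
  (0 < #|X|)%N -> (0 < d)%N -> (0 < b)%N ->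
  (forall Y : {set X}, (d <= #|Y|)%N ->
     #|trace F Y|%:R <= (expR 1 * #|Y|%:R / d%:R) ^+ d :> R) ->
  P \subset F ->
  {in P &, forall S T, S != T -> (#|X| <= b * #|symdiff S T|)%N} ->
  (#|P| < (32 * b) ^ (2 * d))%N.
Proof.
move=> X0 d0 b0 shatter sPF sep; rewrite ltnNge; apply/negP => leNP.
have [Q] : exists Q, Q \in [set Q : {set {set X}} | Q \subset P & #|Q| == ((32 * b) ^ (2 * d))%N].
  by apply/card_gt0P; rewrite cards_draws bin_gt0.
rewrite inE => /andP[/subsetP sQP /eqP cQ].
pose m := (d * (128 * b ^ 2))%N.
(* Two distinct members of [Q] differ in at least |X|/b points, so at most (b - 1)|X|/b points,
   rounded down, fail to tell them apart. *)
have small : (#|Q| ^ 2 * ((b.-1 * #|X|) %/ b) ^ m < #|X| ^ m)%N.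
  have bm0 : (0 < b ^ m)%N by rewrite expn_gt0 b0.
  rewrite -(ltn_pmul2r bm0) -mulnA -expnMn.
  apply: leq_ltn_trans (_ : #|Q| ^ 2 * (b.-1 * #|X|) ^ m < _)%N.
    by rewrite leq_mul2l leq_exp2r ?leq_trunc_div ?orbT // /m; lia.
  rewrite expnMn mulnA [ltnRHS]mulnC ltn_pmul2r ?expn_gt0 ?X0 //.
  by rewrite cQ; apply: (power_gap R).
have sepQ : {in Q &, forall S T, S != T ->
    (#|X| - #|symdiff S T| <= (b.-1 * #|X|) %/ b)%N}.
  move=> S T /sQP SP /sQP TP neST; rewrite leq_divRL //.
  by have := sep _ _ SP TP neST; case: (b) b0 => //= c _; lia.
have [Y [cY disY]] := exists_distinguishing_set X0 sepQ small.
have le1 : (#|Q| <= #|trace F Y|)%N.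
  rewrite -(card_in_imset (f := fun S => Y :&: S)) => [|S T SQ TQ].
    apply: subset_leq_card; apply/subsetP => _ /imsetP[S /sQP SP ->].
    by rewrite imset_f // (subsetP sPF).
  by apply: contra_eq; exact: disY.
have r0 : (0 < 128 * b ^ 2)%N by rewrite muln_gt0 expn_gt0 b0.
have := leq_trans le1 (trace_card_le d0 r0 shatter cY).
rewrite cQ expnM leq_exp2r // leqNgt => /negP; apply.
by move: r0; rewrite -mulnn; nia.
Qed.

(** * Nets and chaining *)

Section Nets.
Variables (X : finType) (F : {set {set X}}) (b : nat).

Definition separated (P : {set {set X}}) : bool :=
  [forall S in P, forall T in P, (S != T) ==> (#|X| <= b * #|symdiff S T|)%N].

(** Maximum cardinality implies maximality under inclusion, which yields density. The empty family
    is a valid candidate. *)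
Definition net : {set {set X}} :=
  [arg max_(P > set0 | (P \subset F) && separated P) #|P|].

(** The default [S] is never reached for members of [F], by density of the net. *)
Definition net_proj (S : {set X}) : {set X} :=
  odflt S [pick Q in net | (b * #|symdiff S Q| <= #|X|)%N].

Lemma separatedP (P : {set {set X}}) :
  reflect {in P &, forall S T, S != T -> (#|X| <= b * #|symdiff S T|)%N}
    (separated P).
Proof.
apply: (iffP forall_inP) => [h S T SP TP|h S SP].
  by apply/implyP; exact: (forall_inP (h S SP)).
by apply/forall_inP => T TP; apply/implyP; exact: h.
Qed.

Lemma net_spec : [/\ net \subset F, separated net &
  forall P : {set {set X}}, P \subset F -> separated P -> (#|P| <= #|net|)%N].
Proof.
rewrite /net; case: arg_maxnP => [|P /andP[sPF sepP] maxP].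
  by rewrite sub0set; apply/separatedP => S T; rewrite inE.
by split=> // Q sQF sepQ; apply: maxP; rewrite sQF.
Qed.

Lemma net_sub : net \subset F. Proof. by case: net_spec. Qed.

Lemma symdiffC (S T : {set X}) : symdiff S T = symdiff T S.
Proof. exact: setUC. Qed.

(** A member of [F] far from the whole net could be added to it, contradicting maximality. *)
Lemma net_dense (S : {set X}) : S \in F ->
  exists2 Q, Q \in net & (b * #|symdiff S Q| <= #|X|)%N.
Proof.
move=> SF; have [sNF /separatedP sepN maxN] := net_spec.
have [SN|SN] := boolP (S \in net).
  by exists S; rewrite // /symdiff setDv setU0 cards0 muln0.
apply/exists_inP; apply: contraT; rewrite negb_exists_in => /forall_inP far.
suff : (#|S |: net| <= #|net|)%N by rewrite cardsU1 SN ltnn.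
apply: maxN; first by rewrite subUset sub1set SF.
apply/separatedP => U V; rewrite !inE.
move=> /orP[/eqP->|UN] /orP[/eqP->|VN]; rewrite ?eqxx // => neUV.
- by have := far V VN; rewrite -ltnNge => /ltnW.
- by have := far U UN; rewrite -ltnNge symdiffC => /ltnW.
- exact: sepN.
Qed.

Lemma net_projP (S : {set X}) : S \in F ->
  net_proj S \in net /\ (b * #|symdiff S (net_proj S)| <= #|X|)%N.
Proof.
move=> /net_dense[Q QN hQ]; rewrite /net_proj.
case: pickP => [T /andP[]|/(_ Q)] //=; by rewrite QN hQ.
Qed.

End Nets.

(** * Union bounds for the sampling probability *)

Section SampleProb.
Variables (R : realType) (X : finType) (t : nat).
Implicit Types E : pred {set X}.

Lemma sample_prob_mono E1 E2 :
  (forall A : {set X}, #|A| = t -> E1 A -> E2 A) ->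
  sample_prob R t E1 <= sample_prob R t E2.
Proof.
move=> h; rewrite ler_wpM2r ?invr_ge0 // ler_nat subset_leq_card //.
by apply/subsetP => A; rewrite !inE => /andP[/eqP cA /(h A cA) ->]; rewrite cA eqxx.
Qed.

Lemma sample_probU E1 E2 :
  sample_prob R t (fun A => E1 A || E2 A)
    <= sample_prob R t E1 + sample_prob R t E2.
Proof.
rewrite -mulrDl ler_wpM2r ?invr_ge0 // -natrD ler_nat.
apply: leq_trans (leq_card_setU _ _); apply: subset_leq_card.
by apply/subsetP => A; rewrite !inE -andb_orr.
Qed.

Lemma sample_prob_exists (I : finType) (P : pred I) (E : I -> pred {set X}) :
  sample_prob R t (fun A => [exists (i | P i), E i A])
    <= \sum_(i | P i) sample_prob R t (E i).
Proof.
rewrite -mulr_suml ler_wpM2r ?invr_ge0 // -natr_sum ler_nat.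
apply: leq_trans (_ : (#|\bigcup_(i | P i) [set A : {set X} | (#|A| == t) && E i A]| <= _)%N).
  apply: subset_leq_card; apply/subsetP => A.
  rewrite inE => /andP[cA /existsP[i /andP[Pi Ei]]].
  by apply/bigcupP; exists i; rewrite // inE cA.
elim/big_ind2: _ => // [|A1 n1 A2 n2 h1 h2]; first by rewrite cards0.
by rewrite (leq_trans (leq_card_setU _ _)) // leq_add.
Qed.

Lemma sample_probC E : (t <= #|X|)%N ->
  sample_prob R t E = 1 - sample_prob R t (predC E).
Proof.
move=> tX; have C0 : 'C(#|X|, t)%:R != 0 :> R.
  by rewrite pnatr_eq0 -lt0n bin_gt0.
apply/eqP; rewrite eq_sym subr_eq -mulrDl -natrD.
have -> : (#|[set A : {set X} | (#|A| == t) && E A]|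
    + #|[set A : {set X} | (#|A| == t) && predC E A]| = 'C(#|X|, t))%N.
  rewrite -card_draws -(cardsID [set A | E A] [set A : {set X} | #|A| == t]).
  by congr (_ + _)%N; apply: eq_card => A; rewrite !inE // andbC.
by rewrite divff.
Qed.

Lemma sample_prob_disc (S : {set X}) (s h : R) :
  (0 < #|X|)%N -> (0 < t <= #|X|)%N ->
  #|S|%:R / #|X|%:R <= s -> 0 < h <= 2 * s ->
  sample_prob R t (fun A => h < `|disc R A S|)
    <= 2 * expR (- (t%:R * h ^+ 2 / (8 * s))).
Proof.
move=> X0 tX pS hs; rewrite /sample_prob ler_pdivrMr ?sample_tail //.
by rewrite ltr0n bin_gt0; case/andP: tX.
Qed.

Lemma card_setD_density (S T : {set X}) (b : nat) (s : R) :
  (0 < #|X|)%N -> (0 < b)%N -> (b * #|symdiff S T| <= #|X|)%N ->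
  b%:R^-1 <= s -> #|S :\: T|%:R / #|X|%:R <= s.
Proof.
move=> X0 b0 near bs; apply: le_trans bs.
rewrite ler_pdivrMr ?ltr0n // -[leRHS]mulrC ler_pdivlMr ?ltr0n // -natrM ler_nat.
apply: leq_trans near; rewrite mulnC leq_mul2l subset_leq_card ?orbT //.
exact: subsetUl.
Qed.

(** Each one-sided difference has density at most s and contributes two tails. *)
Lemma sample_prob_link (S T : {set X}) (b : nat) (s h : R) :
  (0 < #|X|)%N -> (0 < t <= #|X|)%N ->
  (0 < b)%N -> (b * #|symdiff S T| <= #|X|)%N -> b%:R^-1 <= s ->
  0 < h <= 2 * s ->
  sample_prob R t (fun A => (h < `|disc R A (S :\: T)|) || (h < `|disc R A (T :\: S)|))
    <= 4 * expR (- (t%:R * h ^+ 2 / (8 * s))).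
Proof.
move=> X0 tX b0 near bs hs; apply: le_trans (sample_probU _ _) _.
have -> : 4 = 2 + 2 :> R by rewrite -natrD.
rewrite mulrDl lerD // sample_prob_disc //.
  exact: card_setD_density near bs.
by rewrite symdiffC in near; exact: card_setD_density near bs.
Qed.

End SampleProb.

(** * Deterministic chaining *)

Section Chaining.
Variables (R : realType) (X : finType).

(** Split S and T along their intersection; its discrepancy cancels. *)
Lemma disc_setD (A S T : {set X}) :
  disc R A S = disc R A T + disc R A (S :\: T) - disc R A (T :\: S).
Proof.
have E (B U V : {set X}) : #|B :&: U|%:R
    = #|B :&: (U :&: V)|%:R + #|B :&: (U :\: V)|%:R :> R.
  rewrite -natrD -(cardsID V (B :&: U)).
  by rewrite -setIA setDE -setIA -setDE.
have E1 (U V : {set X}) : #|U|%:R = #|U :&: V|%:R + #|U :\: V|%:R :> R.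
  by rewrite -natrD cardsID.
by rewrite /disc (E A S T) (E A T S) (E1 S T) (E1 T S) (setIC T S); ring.
Qed.

Lemma disc_link (A S T : {set X}) (h : R) :
  `|disc R A (S :\: T)| <= h -> `|disc R A (T :\: S)| <= h ->
  `|disc R A S| <= `|disc R A T| + 2 * h.
Proof.
move=> h1 h2; rewrite (disc_setD A S T) -addrA.
apply: le_trans (ler_normD _ _) _; rewrite lerD2l.
by apply: le_trans (ler_normB _ _) _; lra.
Qed.

Lemma density_link (S T : {set X}) (b : nat) (s : R) :
  (0 < #|X|)%N -> (0 < b)%N -> (b * #|symdiff S T| <= #|X|)%N -> b%:R^-1 <= s ->
  #|T|%:R / #|X|%:R <= #|S|%:R / #|X|%:R + s.
Proof.
move=> X0 b0 near bs; rewrite symdiffC in near.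
apply: le_trans (lerD (lexx _) (card_setD_density X0 b0 near bs)).
rewrite -mulrDl ler_wpM2r ?invr_ge0 // -natrD ler_nat -(cardsID S T).
by rewrite leq_add2r subset_leq_card // subsetIr.
Qed.

Variables (F : {set {set X}}) (b : nat) (eps delta : R).
Hypotheses (X0 : (0 < #|X|)%N) (b0 : (0 < b)%N) (beps : b%:R^-1 <= eps).
Hypotheses (eps0 : 0 < eps) (delta0 : 0 < delta).

Definition level (i : nat) : nat := (b * 16 ^ i)%N.

Lemma level_gt0 i : (0 < level i)%N.
Proof. by rewrite muln_gt0 b0 expn_gt0. Qed.

Lemma level_inv_le i : (level i)%:R^-1 <= eps / 16 ^+ i.
Proof.
rewrite natrM natrX invfM ler_pM2r //.
by rewrite invr_gt0 exprn_gt0.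
Qed.

(** Allowances shrink like 2^(-i) while densities shrink like 16^(-i), so the Chernoff exponent h^2
    / s gains 16^i / 4^i = 4^i. *)
Definition step i : R := delta * eps / 16 / 2 ^+ i.

(** In units of delta eps / 16, link i costs at most 1 / 2^i for the change of density and 2 / 2^i
    for the two differences. The total 3 / 2^i is the increment of 6 - 6 / 2^i. *)
Lemma chaining (A : {set X}) (k : nat) :
  {in net F (level 0), forall S,
    `|disc R A S| <= delta / 16 * Num.max (#|S|%:R / #|X|%:R) eps} ->
  (forall i, (i < k)%N -> {in net F (level i.+1), forall S,
    let T := net_proj F (level i) S in
    `|disc R A (S :\: T)| <= step i /\ `|disc R A (T :\: S)| <= step i}) ->
  forall i, (i <= k)%N -> {in net F (level i), forall S,
    `|disc R A S| <= delta / 16 *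
      (Num.max (#|S|%:R / #|X|%:R) eps + (6 - 6 / 2 ^+ i) * eps)}.
Proof.
move=> base links; elim=> [_ S SN|i IH ltik S SN].
  by apply: le_trans (base S SN) _; rewrite expr0 divr1 subrr mul0r addr0.
have SF : S \in F := subsetP (net_sub F _) S SN.
have [TN near] := net_projP (level i) SF.
have [h1 h2] := links i ltik S SN; set T := net_proj F (level i) S in TN near h1 h2.
apply: le_trans (disc_link h1 h2) _.
apply: le_trans (lerD (IH (ltnW ltik) T TN) (lexx _)) _.
have pT := density_link X0 (level_gt0 i) near (level_inv_le i).
have q0 : 0 < (2 ^+ i)^-1 :> R by rewrite invr_gt0 exprn_gt0.
have le16 : (16 ^+ i)^-1 <= (2 ^+ i)^-1 :> R.
  by rewrite lef_pV2 ?posrE ?exprn_gt0 // lerXn2r ?nnegrE //; lra.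
have maxle : Num.max (#|T|%:R / #|X|%:R) eps
    <= Num.max (#|S|%:R / #|X|%:R) eps + eps / 2 ^+ i.
  have e1 : eps / 16 ^+ i <= eps / 2 ^+ i by rewrite ler_pM2l.
  have e2 : 0 < eps / 2 ^+ i by rewrite mulr_gt0.
  rewrite ge_max; apply/andP; split.
    apply: le_trans pT _; apply: lerD e1; by rewrite le_max lexx.
  by apply: (le_trans (y := Num.max (#|S|%:R / #|X|%:R) eps)); [rewrite le_max lexx orbT | rewrite lerDl ltW].
set m := Num.max _ eps in maxle *; set m' := Num.max _ eps in maxle *.
have -> : delta / 16 * (m + (6 - 6 / 2 ^+ i) * eps) + 2 * step i
    = delta / 16 * (m + (6 - 4 / 2 ^+ i) * eps).
  by rewrite /step; field; rewrite expf_neq0 ?pnatr_eq0.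
have -> : 6 - 6 / 2 ^+ i.+1 = 6 - 3 / 2 ^+ i :> R.
  by rewrite exprS; field; rewrite expf_neq0 ?pnatr_eq0.
rewrite ler_pM2l ?divr_gt0 //.
have -> : m' + (6 - 3 / 2 ^+ i) * eps = (m' + eps / 2 ^+ i) + (6 - 4 / 2 ^+ i) * eps by ring.
by rewrite lerD2r.
Qed.

(** With m the maximum of the density of S and eps, the maximum for the projection of S is at most
    2m. The chain adds at most 6 eps and the last link 2 eps, and (2m + 8m) / 16 <= m. *)
Lemma chaining_approx (A : {set X}) (k : nat) :
  {in net F (level 0), forall S,
    `|disc R A S| <= delta / 16 * Num.max (#|S|%:R / #|X|%:R) eps} ->
  (forall i, (i < k)%N -> {in net F (level i.+1), forall S,
    let T := net_proj F (level i) S in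
    `|disc R A (S :\: T)| <= step i /\ `|disc R A (T :\: S)| <= step i}) ->
  {in F, forall S, let T := net_proj F (level k) S in
    `|disc R A (S :\: T)| <= step 0 /\ `|disc R A (T :\: S)| <= step 0} ->
  relative_approx F eps delta A.
Proof.
move=> base links last; apply/forall_inP => S SF.
have [TN near] := net_projP (level k) SF.
have [h1 h2] := last S SF; set T := net_proj F (level k) S in TN near h1 h2.
have := disc_link h1 h2; rewrite /disc => /le_trans; apply.
have := chaining base links (leqnn k) TN; rewrite /disc => h.
apply: le_trans (lerD h (lexx _)) _.
have pT := density_link X0 (level_gt0 k) near (level_inv_le k).
have q0 : 0 < (2 ^+ k)^-1 :> R by rewrite invr_gt0 exprn_gt0.
have le1 : eps / 16 ^+ k <= eps.
  by rewrite ler_pdivrMr ?exprn_gt0 // ler_pMr // exprn_ege1 // ler1n.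
set p := #|S|%:R / #|X|%:R in pT *; set q := #|T|%:R / #|X|%:R in pT *.
have mp : p <= Num.max p eps by rewrite le_max lexx.
have me : eps <= Num.max p eps by rewrite le_max lexx orbT.
set m := Num.max p eps in mp me *.
have mq : Num.max q eps <= 2 * m by rewrite ge_max; apply/andP; split; move: (eps0); lra.
rewrite /step expr0 divr1.
have -> : delta / 16 * (Num.max q eps + (6 - 6 / 2 ^+ k) * eps) + 2 * (delta * eps / 16)
  = delta * ((Num.max q eps + (8 - 6 / 2 ^+ k) * eps) / 16).
  by field; rewrite expf_neq0 ?pnatr_eq0.
rewrite ler_pM2l // ler_pdivrMr //; set c := 6 / 2 ^+ k.
have : 0 <= c * eps by rewrite mulr_ge0 ?mulr_ge0 // ltW.
move: (eps0) mq me; move: (Num.max q eps) (m) (c) => u v w; lra.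
Qed.

End Chaining.

(** * Failure probabilities *)

(** Powers of M = 1 / (eps^d gamma): 8i + 22 for the net, 2 for the factor 4, i + 2 for the share
    2^(i + 2) of gamma. *)
Lemma level_exponent_split (i : nat) :
  (9 * i + 26 = (8 * i + 22) + 2 + (i + 2))%N.
Proof. lia. Qed.

Lemma level_exponent_le (i : nat) : ((9 * i + 26).+1 <= 32 * 4 ^ i)%N.
Proof. by elim: i => // i; rewrite expnS; lia. Qed.

Section Numerics.
Variables (R : realType) (eps delta gamma : R) (d : nat).
Hypotheses (eps_bounds : 0 < eps < 1 / 2) (delta_bounds : 0 < delta < 1 / 2)
  (gamma_bounds : 0 < gamma < 1 / 2) (d0 : (0 < d)%N).

(** Common unit of the estimates: [M] dominates both 2^d and eps^(-d), so net sizes and tail bounds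
    are compared as powers of [M]. *)
Let M : R := 1 / (eps ^+ d * gamma).

Let eps0 : 0 < eps. Proof. by case/andP: eps_bounds. Qed.
Let delta0 : 0 < delta. Proof. by case/andP: delta_bounds. Qed.
Let gamma0 : 0 < gamma. Proof. by case/andP: gamma_bounds. Qed.

Let eps_lt : eps < 1 / 2. Proof. by case/andP: eps_bounds. Qed.
Let gamma_lt : gamma < 1 / 2. Proof. by case/andP: gamma_bounds. Qed.

Let epsV_ge2 : 2 <= eps^-1.
Proof. by rewrite -[eps^-1]mul1r ler_pdivlMr //; move: eps_lt; lra. Qed.

Let gammaM : gamma * M = eps^-1 ^+ d.
Proof. by rewrite /M exprVn; field; rewrite expf_neq0 ?gt_eqF. Qed.

Let M_gt0 : 0 < M.
Proof. by rewrite divr_gt0 ?mulr_gt0 ?exprn_gt0. Qed.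

Let M_ge0 : 0 <= M. Proof. exact: ltW. Qed.
Let epsV_ge0 : 0 <= eps^-1. Proof. by rewrite invr_ge0 ltW. Qed.

Let epsVd_leM : eps^-1 ^+ d <= M.
Proof. by rewrite -gammaM ler_piMl //; move: (gamma_lt); lra. Qed.

Let two_leM : 2 ^+ d <= M.
Proof. by apply: le_trans epsVd_leM; rewrite lerXn2r ?nnegrE . Qed.

Let M_ge2 : 2 <= M.
Proof. by apply: le_trans two_leM; rewrite -[leLHS]expr1 ler_eXn2l // ltr1n. Qed.

Let M_ge1 : 1 <= M. Proof. by apply: le_trans M_ge2; lra. Qed.

(** Before squaring, the base is at most (2^d)^(j + 1) eps^(-d), hence at most M^(j + 2). This
    absorbs the dimension d. *)
Lemma scale_power_le (b j : nat) : b%:R <= 2 / eps ->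
  (2 ^+ j * b%:R) ^+ (2 * d) <= M ^+ (2 * (j + 2)).
Proof.
move=> bE; rewrite mulnC [(2 * (j + 2))%N]mulnC !exprM lerXn2r ?nnegrE //.
- by rewrite exprn_ge0 // mulr_ge0 // exprn_ge0.
- by rewrite exprn_ge0.
apply: le_trans (_ : (2 ^+ j.+1 * eps^-1) ^+ d <= _).
  rewrite lerXn2r ?nnegrE ?mulr_ge0 ?exprn_ge0  // exprSr -mulrA.
  by rewrite ler_pM2l ?exprn_gt0.
rewrite exprMn -exprM mulnC exprM addn2.
rewrite [leRHS]exprSr ler_pM ?exprn_ge0  //.
by rewrite lerXn2r ?nnegrE ?exprn_ge0.
Qed.

(** Since 2^16 / 2048 = 32, the lower bound on t makes the exponent at least 32 4^i ln M. *)
Lemma level_tail (t i : nat) (x : R) :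
  2 ^+ 16 * (1 / (eps * delta ^+ 2) * ln M) <= t%:R ->
  t%:R * (delta ^+ 2 * eps) / 2048 * 4 ^+ i <= x ->
  expR (- x) <= M^-1 ^+ (32 * 4 ^ i).
Proof.
move=> tE xE.
have -> : M^-1 = expR (- ln M) by rewrite expRN lnK ?posrE.
rewrite -expRM_natl ler_expR mulrN lerN2; apply: le_trans xE.
have : 32 * ln M <= t%:R * (delta ^+ 2 * eps) / 2048.
  rewrite ler_pdivlMr // -ler_pdivrMr ?mulr_gt0 ?exprn_gt0 //.
  apply: le_trans tE; rewrite le_eqVlt; apply/orP; left; apply/eqP.
  by field; rewrite !gt_eqF.
rewrite -(ler_pM2r (_ : 0 < 4 ^+ i)) ?exprn_gt0 // => /(le_trans _); apply.
by rewrite natrM natrX mulrAC.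
Qed.

(** Here 4 <= M^2 and 2^(i + 2) <= M^(i + 2); one more factor M pays for gamma, since gamma M =
    eps^(-d) >= 1. *)
Lemma level_failure_le (a : R) (i : nat) : a <= M ^+ (8 * i + 22) ->
  a * (4 * M^-1 ^+ (32 * 4 ^ i)) <= gamma / 2 ^+ (i + 2).
Proof.
move=> aE; have p0 : 0 < 2 ^+ (i + 2) :> R by rewrite exprn_gt0.
have q0 : 0 < M ^+ (32 * 4 ^ i) by rewrite exprn_gt0.
rewrite ler_pdivlMr // exprVn mulrA mulrAC ler_pdivrMr //.
have e4 : 4 <= M ^+ 2.
  rewrite expr2; apply: le_trans (_ : 2 * 2 <= _); first by rewrite -natrM.
  by rewrite ler_pM.
have e2 : 2 ^+ (i + 2) <= M ^+ (i + 2) by rewrite lerXn2r ?nnegrE.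
have step1 : a * 4 * 2 ^+ (i + 2) <= M ^+ (9 * i + 26).
  have h4 : a * 4 <= M ^+ (8 * i + 22) * M ^+ 2.
    apply: le_trans (ler_wpM2r (ler0n _ 4) aE) _.
    by rewrite ler_wpM2l // exprn_ge0.
  apply: le_trans (ler_wpM2r (ltW p0) h4) _.
  by rewrite level_exponent_split (exprD M (8 * i + 22 + 2)) (exprD M (8 * i + 22)) ler_wpM2l // mulr_ge0 // exprn_ge0.
apply: le_trans step1 _.
apply: le_trans (_ : gamma * M ^+ (9 * i + 26).+1 <= _).
  rewrite exprS mulrA gammaM ler_peMl ?exprn_ge0 //.
  by rewrite exprn_ege1 //; move: epsV_ge2; lra.
by rewrite ler_pM2l // ler_weXn2l // level_exponent_le.
Qed.

(** With y = gamma / N <= 1/2 the tail is at most y^32; one factor y cancels N, and 4 y^31 <=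
    1/4. *)
Lemma last_failure_le (N : nat) (t : nat) (x : R) : (0 < N)%N ->
  2 ^+ 16 * (1 / (eps * delta) * ln (N%:R / gamma)) <= t%:R ->
  t%:R * (delta * eps) / 2048 <= x ->
  N%:R * (4 * expR (- x)) <= gamma / 4.
Proof.
move=> N0 tE xE; have Np : 0 < N%:R :> R by rewrite ltr0n.
have h : 32 * ln (N%:R / gamma) <= x.
  apply: le_trans xE; rewrite ler_pdivlMr // -ler_pdivrMr ?mulr_gt0 //.
  apply: le_trans tE; rewrite le_eqVlt; apply/orP; left; apply/eqP.
  by field; rewrite !gt_eqF.
pose y := gamma / N%:R.
have y0 : 0 < y by rewrite divr_gt0.
have y1 : y <= 1 / 2.
  rewrite ler_pdivrMr //; have : 1 <= N%:R :> R by rewrite ler1n.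
  by move: gamma_lt; lra.
have ex : expR (- x) <= y ^+ 32.
  have -> : y = expR (- ln (N%:R / gamma)).
    by rewrite expRN lnK ?posrE ?divr_gt0 // invf_div.
  by rewrite -expRM_natl ler_expR mulrN lerN2.
have Ny : N%:R * y = gamma by rewrite /y; field; rewrite gt_eqF.
apply: le_trans (_ : N%:R * (4 * y ^+ 32) <= _).
  by rewrite ler_pM2l // ler_pM2l.
have -> : N%:R * (4 * y ^+ 32) = gamma * (4 * y ^+ 31).
  by rewrite -Ny exprS; move: (y ^+ 31) => u; ring.
rewrite ler_pM2l //.
have : y ^+ 31 <= y ^+ 4 by rewrite ler_wiXn2l ?ltW //; lra.
have : y ^+ 4 <= (1 / 2) ^+ 4 by rewrite lerXn2r ?nnegrE ?divr_ge0 // ltW.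
have -> : (1 / 2) ^+ 4 = 1 / 16 :> R by rewrite expr_div_n expr1n -natrX.
lra.
Qed.

Lemma sum_geometric_le (k : nat) : \sum_(i < k) gamma / 2 ^+ (i + 2) <= gamma / 2.
Proof.
have -> : \sum_(i < k) gamma / 2 ^+ (i + 2) = gamma / 2 - gamma / 2 / 2 ^+ k.
  elim: k => [|k IH]; first by rewrite big_ord0 expr0 divr1 subrr.
  rewrite big_ord_recr /= IH addn2 !exprS; field.
  by rewrite expf_neq0 ?pnatr_eq0.
by rewrite lerBlDr lerDl divr_ge0 ?divr_ge0 ?exprn_ge0 ?ltW.
Qed.

End Numerics.

(** * Choice of the scales *)

Lemma exists_last_scale (R : realType) (delta : R) : 0 < delta ->
  exists k : nat, (16 ^+ k)^-1 <= delta /\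
    forall i, (i < k)%N -> delta <= (16 ^+ i)^-1.
Proof.
move=> delta0.
have ex : exists k : nat, (16 ^+ k)^-1 <= delta.
  have [n hn] := ltr_add_invr (y := 0) delta0.
  exists n; rewrite add0r in hn; apply: le_trans (ltW hn).
  rewrite lef_pV2 ?posrE ?exprn_gt0 ?ltr0n // -natrX ler_nat.
  by apply: leq_trans (ltn_expl n (isT : 1 < 16)%N) _.
exists (ex_minn ex); case: ex_minnP => k hk mink; split=> // i ltik.
by rewrite leNgt; apply/negP => /ltW /mink; rewrite leqNgt ltik.
Qed.

(** Passing to the next integer above 1/eps costs at most a factor 2, as 1/eps >= 1. *)
Lemma exists_inverse_scale (R : realType) (eps : R) : 0 < eps < 1 / 2 ->
  exists b : nat, [/\ (0 < b)%N, b%:R^-1 <= eps & b%:R <= 2 / eps].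
Proof.
move=> /andP[eps0 epsh].
have e2 : 1 <= eps^-1 by rewrite invf_ge1 //; lra.
have /andP[h1 h2] := truncn_itv (ltW (lt_le_trans ltr01 e2)).
exists (Num.truncn eps^-1).+1; split=> //.
  by rewrite -[leRHS]invrK lef_pV2 ?posrE ?invr_gt0 ?ltr0n // ltW.
rewrite -natr1; have -> : 2 / eps = eps^-1 + eps^-1 by field; rewrite gt_eqF.
by rewrite lerD.
Qed.

Lemma sample_prob_exists_card (R : realType) (X : finType) (t : nat)
    (H : {set {set X}}) (E : {set X} -> pred {set X}) (c : R) :
  {in H, forall S, sample_prob R t (E S) <= c} ->
  sample_prob R t (fun A => [exists (S | S \in H), E S A]) <= #|H|%:R * c.
Proof.
move=> h; apply: le_trans (sample_prob_exists _ _ _ _) _.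
apply: le_trans (ler_sum _ h) _.
by rewrite sumr_const mulr_natl.
Qed.

(** * Union bounds along the chain *)

Section FailureProbabilities.
Variables (R : realType) (X : finType) (F : {set {set X}}) (d b k t : nat).
Variables (eps delta gamma : R).
Hypotheses (eps_bounds : 0 < eps < 1 / 2) (delta_bounds : 0 < delta < 1 / 2)
  (gamma_bounds : 0 < gamma < 1 / 2) (d0 : (0 < d)%N).
Hypotheses (X0 : (0 < #|X|)%N) (tX : (0 < t <= #|X|)%N).
Hypothesis shatter : forall Y : {set X}, (d <= #|Y|)%N ->
  #|trace F Y|%:R <= (expR 1 * #|Y|%:R / d%:R) ^+ d :> R.
Hypotheses (b0 : (0 < b)%N) (beps : b%:R^-1 <= eps) (epsb : b%:R <= 2 / eps).
Hypotheses (lek : (16 ^+ k)^-1 <= delta)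
  (gek : forall i, (i < k)%N -> delta <= (16 ^+ i)^-1).
Hypotheses
  (t_cardF : 2 ^+ 16 * (1 / (eps * delta) * ln (#|F|%:R / gamma)) <= t%:R)
  (t_dim : 2 ^+ 16 * (1 / (eps * delta ^+ 2) * ln (1 / (eps ^+ d * gamma))) <= t%:R).

Let eps0 : 0 < eps. Proof. by case/andP: eps_bounds. Qed.
Let delta0 : 0 < delta. Proof. by case/andP: delta_bounds. Qed.
Let gamma0 : 0 < gamma. Proof. by case/andP: gamma_bounds. Qed.

Definition link_fails (i : nat) (h : R) (S A : {set X}) : bool :=
  let T := net_proj F (level b i) S in
  (h < `|disc R A (S :\: T)|) || (h < `|disc R A (T :\: S)|).

(** The packing bound has base 32 b 16^i = 2^(4i + 5) b, and 2 ((4i + 5) + 2) = 8i + 14. *)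
Lemma card_net_le (i : nat) :
  #|net F (level b i)|%:R <= (1 / (eps ^+ d * gamma)) ^+ (8 * i + 14).
Proof.
have -> : (8 * i + 14 = 2 * ((4 * i + 5) + 2))%N by lia.
apply: le_trans (scale_power_le d eps_bounds gamma_bounds (4 * i + 5) epsb).
have [sNF /separatedP sepN _] := net_spec F (level b i).
have := card_separated_lt X0 d0 (level_gt0 b0 i) shatter sNF sepN.
move=> /ltnW; rewrite -(ler_nat R) natrX => /le_trans; apply.
rewrite lerXn2r ?nnegrE ?mulr_ge0 ?exprn_ge0 // -natrX -natrM ler_nat.
rewrite /level expnD expnM (_ : 2 ^ 4 = 16)%N // (_ : 2 ^ 5 = 32)%N //.
by move: (16 ^ i)%N => u; clear; nia.
Qed.

(** Net members at level 0 may be dense, so the tail bound is used with s = max(density, eps) and h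
    = delta s / 16; its exponent t delta^2 s / 2048 is smallest at s = eps. *)
Lemma base_failure :
  sample_prob R t (fun A => [exists (S | S \in net F (level b 0)),
    delta / 16 * Num.max (#|S|%:R / #|X|%:R) eps < `|disc R A S|]) <= gamma / 4.
Proof.
have card0 : #|net F (level b 0)|%:R <= (1 / (eps ^+ d * gamma)) ^+ (8 * 0 + 22).
  apply: le_trans (card_net_le 0) _; rewrite ler_weXn2l //.
  rewrite ler_pdivlMr ?mulr_gt0 ?exprn_gt0 // mul1r mulr_ile1 ?exprn_ge0 ?exprn_ile1 ?(ltW eps0) ?(ltW gamma0) //.
    by case/andP: eps_bounds => _; lra.
  by case/andP: gamma_bounds => _; lra.
have := level_failure_le eps_bounds gamma_bounds d0 card0.
have -> : 2 ^+ (0 + 2) = 4 :> R by rewrite -natrX.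
apply: le_trans; apply: sample_prob_exists_card => S SN.
set m := Num.max _ eps.
have m0 : eps <= m by rewrite le_max lexx orbT.
have mp : 0 < m := lt_le_trans eps0 m0.
apply: le_trans (sample_prob_disc (s := m) X0 tX _ _) _; first by rewrite le_max lexx.
  rewrite mulr_gt0 ?divr_gt0 //= ler_pM2r //.
  by case/andP: delta_bounds => _; lra.
apply: ler_pM; rewrite ?expR_ge0 //.
  by rewrite ler_nat.
apply: level_tail t_dim _ => //.
have -> : t%:R * (delta / 16 * m) ^+ 2 / (8 * m) = t%:R * (delta ^+ 2 * m) / 2048.
  by field; rewrite gt_eqF.
by rewrite expr0 mulr1 ler_pM2r ?invr_gt0 // ler_wpM2l // ler_pM2l // exprn_gt0.
Qed.

(** Link i starts in the net of level i + 1, whence the exponent 8(i + 1) + 14 = 8i + 22. *)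
Lemma link_failure :
  sample_prob R t (fun A => [exists (i : 'I_k | true),
    [exists (S | S \in net F (level b i.+1)),
       link_fails i (step eps delta i) S A]]) <= gamma / 2.
Proof.
apply: le_trans (sum_geometric_le gamma_bounds k).
apply: le_trans (sample_prob_exists _ _ _ _) _; apply: ler_sum => i _.
have cardN : #|net F (level b i.+1)|%:R <= (1 / (eps ^+ d * gamma)) ^+ (8 * i + 22).
  have -> : (8 * i + 22 = 8 * i.+1 + 14)%N by lia.
  exact: card_net_le.
apply: le_trans (level_failure_le eps_bounds gamma_bounds d0 cardN).
apply: sample_prob_exists_card => S SN.
have [_ near] := net_projP (level b i) (subsetP (net_sub F _) _ SN).
have u0 : 0 < 2 ^+ i :> R by rewrite exprn_gt0.
have E16 : 16 ^+ i = (2 ^+ i) ^+ 4 :> R.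
  by rewrite -exprM mulnC exprM; congr (_ ^+ _); rewrite -natrX.
have E4 : 4 ^+ i = (2 ^+ i) ^+ 2 :> R.
  by rewrite -exprM mulnC exprM; congr (_ ^+ _); rewrite -natrX.
apply: le_trans (sample_prob_link X0 tX (level_gt0 b0 i) near
  (level_inv_le beps i) _) _.
  rewrite /step divr_gt0 ?divr_gt0 ?mulr_gt0 //=.
  (* Minimality of k gives delta <= 16^(-i) for i < k, which keeps h <= 2 s. *)
  have h1 : delta * eps <= eps / 16 ^+ i by rewrite mulrC ler_pM2l // gek.
  have h2 : delta * eps / 2 ^+ i <= delta * eps.
    by rewrite ler_pdivrMr // ler_pMr ?mulr_gt0 // exprn_ege1 // ler1n.
  have h3 : 0 < eps / 16 ^+ i by rewrite divr_gt0 ?exprn_gt0.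
  by rewrite mulrAC; lra.
apply: ler_pM; rewrite ?expR_ge0 //.
apply: level_tail t_dim _ => //.
rewrite le_eqVlt; apply/orP; left; apply/eqP.
rewrite /step E16 E4; move: (2 ^+ i) u0 => u u0.
by field; rewrite !gt_eqF.
Qed.

(** At level k the differences have density at most eps delta, so the exponent t delta eps / 2048 is
    only linear in delta; hence the first term of the bound on t. *)
Lemma last_link_failure :
  sample_prob R t (fun A => [exists (S | S \in F),
    link_fails k (step eps delta 0) S A]) <= gamma / 4.
Proof.
apply: le_trans (_ : #|F|%:R * (4 * expR (- (t%:R * step eps delta 0 ^+ 2 / (8 * (eps * delta))))) <= _).
  apply: sample_prob_exists_card => S SF.
  have [_ near] := net_projP (level b k) SF.
  apply: sample_prob_link X0 tX (level_gt0 b0 k) near _ _.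
    by apply: le_trans (level_inv_le beps k) _; rewrite ler_pM2l.
  have h : 0 < eps * delta by rewrite mulr_gt0.
  by rewrite /step expr0 divr1 [delta * _]mulrC; lra.
case: (posnP #|F|) => [->|F0]; first by rewrite mul0r divr_ge0 // ltW.
apply: (last_failure_le eps_bounds delta_bounds gamma_bounds F0 t_cardF).
rewrite le_eqVlt; apply/orP; left; apply/eqP.
by rewrite /step expr0; field; rewrite !gt_eqF.
Qed.

Lemma approximation_failure :
  sample_prob R t (predC (relative_approx F eps delta)) <= gamma.
Proof.
have -> : gamma = (gamma / 4 + gamma / 2) + gamma / 4 by field.
apply: le_trans (lerD (lerD base_failure link_failure) last_link_failure).
apply: le_trans (lerD (sample_probU _ _ _ _) (lexx _)).
apply: le_trans (sample_probU _ _ _ _).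
apply: sample_prob_mono => A _; apply: contraR.
rewrite !negb_or => /andP[/andP[ok0 ok1] ok2].
apply: (@chaining_approx R X F b eps delta X0 b0 beps eps0 delta0 A k) => [S SN|i ltik S SN|S SF].
- by move: ok0; rewrite negb_exists_in => /forall_inP /(_ S SN); rewrite -leNgt.
- move: ok1; rewrite negb_exists => /forallP /(_ (Ordinal ltik)) /=.
  rewrite negb_exists_in => /forall_inP /(_ S SN).
  by rewrite negb_or -!leNgt => /andP.
- move: ok2; rewrite negb_exists_in => /forall_inP /(_ S SF).
  by rewrite negb_or -!leNgt => /andP.
Qed.

End FailureProbabilities.

Theorem theorem4 (R : realType) :
  exists c2 : R, 0 < c2 /\
    forall (X : finType) (F : {set {set X}}) (d : nat),
      (1 <= d)%N ->
      (forall Y : {set X}, (d <= #|Y|)%N ->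
        #|trace F Y|%:R <= (expR 1 * #|Y|%:R / d%:R) ^+ d :> R) ->
      forall delta eps gamma : R,
        0 < delta < 1 / 2 -> 0 < eps < 1 / 2 -> 0 < gamma < 1 / 2 ->
        forall t : nat,
          (t <= #|X|)%N ->
          c2 * Num.max (1 / (eps * delta) * ln (#|F|%:R / gamma))
                       (1 / (eps * delta ^+ 2) * ln (1 / (eps ^+ d * gamma)))
            <= t%:R ->
          1 - gamma <= sample_prob R t (relative_approx F eps delta).
Proof.
have c0 : 0 < 2 ^+ 16 :> R by rewrite exprn_gt0.
(* 2^16 = 32 (8 16^2): the 8 is Chernoff's, the 16 divides the allowances, and 32 covers the union
   bounds. *)
exists (2 ^+ 16); split=> // X F d d0 shatter delta eps gamma hd he hg t tX.
rewrite maxr_pMr ?(ltW c0) // ge_max => /andP[t1 t2].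
have /andP[eps0 eps1] := he; have /andP[delta0 _] := hd; have /andP[gamma0 gamma1] := hg.
(* As eps^d gamma < 1, the logarithm in the second term is positive, which forces t > 0 and hence X
   nonempty. *)
have t0 : (0 < t)%N.
  rewrite -(ltr0n R); apply: lt_le_trans t2; rewrite mulr_gt0 // mulr_gt0 //.
    by rewrite divr_gt0 ?mulr_gt0 ?exprn_gt0.
  rewrite ln_gt0 // ltr_pdivlMr ?mulr_gt0 ?exprn_gt0 // mul1r.
  apply: le_lt_trans (_ : gamma < _); last lra.
  by rewrite ler_piMl ?exprn_ile1 ?ltW //; lra.
have X0 : (0 < #|X|)%N := leq_trans t0 tX.
have [b [b0 beps epsb]] := exists_inverse_scale he.
have [k [lek gek]] := exists_last_scale delta0.
rewrite sample_probC // lerD2l lerN2.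
apply: (approximation_failure (d := d) (b := b) (k := k)) => //.
by rewrite t0.
Qed.
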